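(* Consider the cycle aware market mechanism described in the context. If bids $(\beta_i,i\in\mathcal S,\ \alpha_j,j\in\mathcal G)$, together with the resulting optimal dispatch $(g_j,u_i,\nu_i)$ and prices $(\lambda,\Theta_j,\theta_i)$, form a competitive equilibrium of this mechanism, then the dispatch $(g_j,j\in\mathcal G,\ u_i,i\in\mathcal S)$ solves the social planner problem $$\min_{g_j,\,u_i}\ \sum_{i\in\mathcal S}\frac{b_i}{2}u_i^TN_{E_i}(u_i)^TN_{E_i}(u_i)u_i+\sum_{j\in\mathcal G}\frac{c_j}{2}g_j^Tg_j$$ subject to $d=\sum_{j\in\mathcal G}g_j+\sum_{i\in\mathcal S}u_i$, $\ \underline g_j\mathbf 1\le g_j\le\overline g_j\mathbf 1$ for all $j\in\mathcal G$, and $\ \underline u_i\mathbf 1\le u_i\le\overline u_i\mathbf 1$, $\ \mathbf 1^Tu_i=0$, $\ (x_o-1)\mathbf 1\le\tilde A_iu_i\le x_o\mathbf 1$ for all $i\in\mathcal S$.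
   Context: **Storage model.** Fix $T\ge1$. For $u\in\mathbb R^T$ (discharge positive, charge negative) and capacity $E>0$, a state-of-charge (SoC) profile $x=(x_0,\dots,x_T)\in\mathbb R^{T+1}$ satisfies $x_t=x_{t-1}-\frac1E u_t$, i.e. $Ax=-\frac1E u$, where $A\in\mathbb R^{T\times(T+1)}$ has rows $A_{t}=e_{t}^T-e_{t-1}^T$ (columns indexed $0,\dots,T$), $t=1,\dots,T$. **Rainflow.** Given $x$, merge consecutive equal values (keeping the first) and keep the end points and the local extrema (turning points). While there are four consecutive remaining points $p,q,r,s$ with $|x_q-x_r|\le|x_p-x_q|$ and $|x_q-x_r|\le|x_r-x_s|$, take the leftmost such quadruple, record two half-cycles (one full cycle) on the pair $\{q,r\}$, each of depth $|x_q-x_r|$, and delete $q,r$. When no such quadruple remains, record one half-cycle for each pair of consecutive remaining points, with depth the absolute difference of their SoC values. At most $T$ half-cycles are recorded. $\mathrm{Rainflow}(x)=\nu\in\mathbb R^T$ lists the depths, padded with zeros (entries in nonincreasing order, ties in order of extraction). The incidence matrix $M(x)\in\mathbb R^{(T+1)\times T}$ has, for each half-cycle on a pair $\{p,q\}$ with $x_p>x_q$, a column $e_p-e_q$ (columns in the same order as the entries of $\nu$), and zero columns for the padding. So $M(x)^Tx=\nu$. $M(x)$ is unchanged when a constant is added to $x$. Define $N_E(u)=-\frac1E M(x)^TA^\dagger\in\mathbb R^{T\times T}$ ($A^\dagger$ the Moore–Penrose inverse, $x$ any profile with $Ax=-\frac1E u$); then $N_E(u)u=\nu$. **Associated matrices.**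 The map $u\mapsto N_E(u)u$ is piecewise linear. At a given $u$, the associated matrices $N_1(u),\dots,N_m(u)$ are all the distinct matrices obtained as limits of $N_E(u^n)$ along sequences $u^n\to u$ of points near which $N_E$ is locally constant. They satisfy $N_k(u)u=N_E(u)u$ for all $k$. The degradation cost $u\mapsto\frac{b}{2}u^TN_E(u)^TN_E(u)u$ is known to be convex. **Participants and data.** $\mathcal G,\mathcal S$ are finite sets of generators and storage units; $d\in\mathbb R^T$ is the inelastic demand. Generator $j$ has cost $\frac{c_j}{2}g_j^Tg_j$, $c_j>0$, for output $g_j\in\mathbb R^T$, with capacity limits $\underline g_j\le\overline g_j$. Storage $i$ has capacity $E_i>0$, rate limits $\underline u_i\le\overline u_i$, initial and final SoC $x_o\in[0,1]$, and degradation cost $\frac{b_i}{2}u_i^TN_{E_i}(u_i)^TN_{E_i}(u_i)u_i$, $b_i>0$. $\tilde A_i\in\mathbb R^{T\times T}$ is $\frac1{E_i}$ times the lower triangular all-ones matrix. $\mathbf 1$ is the all-ones vector; vector inequalities are entrywise. **Cycle aware market mechanism.** Generator $j$ bids $\alpha_j\ge0$, meaning $g_j=\alpha_j\Theta_j$ at price $\Theta_j\in\mathbb R^T$; storage $i$ bids $\beta_i\ge0$, meaning half-cycle depths $\nu_i=\beta_i\theta_i$ at per-cycle price $\theta_i\in\mathbb R^T$. (A zero bid means zero dispatch of $g_j$, resp. $\nu_i$.) The operator clears the market by solving $$\min_{g_j,u_i,\nu_i}\ \sum_{i\in\mathcal S}\frac1{2\beta_i}\nu_i^T\nu_i+\sum_{j\in\mathcal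 G}\frac1{2\alpha_j}g_j^Tg_j$$ subject to $\nu_i=N_{E_i}(u_i)u_i$ for all $i\in\mathcal S$ (Rainflow constraint), $d=\sum_jg_j+\sum_iu_i$ (power balance), $\underline g_j\mathbf 1\le g_j\le\overline g_j\mathbf 1$, $\underline u_i\mathbf 1\le u_i\le\overline u_i\mathbf 1$, $\mathbf 1^Tu_i=0$, $(x_o-1)\mathbf 1\le\tilde A_iu_i\le x_o\mathbf 1$. Its dual variables are: $\lambda\in\mathbb R^T$ for power balance, $\theta_i\in\mathbb R^T$ for the Rainflow constraint, $\underline\eta_j,\overline\eta_j\ge0$ for the lower and upper generation limits, $\underline\nu_i,\overline\nu_i\ge0$ for the rate limits, $\underline\mu_i,\overline\mu_i\ge0$ for the SoC limits, $\delta_i\in\mathbb R$ for $\mathbf 1^Tu_i=0$. They satisfy complementary slackness and the stationarity conditions $\lambda=\frac{g_j}{\alpha_j}+\overline\eta_j-\underline\eta_j$, $\ \theta_i=\frac{\nu_i}{\beta_i}$, and $\lambda=\sum_{k}\hat\gamma_kN_k(u_i)^T\theta_i+\delta_i\mathbf 1+\tilde A_i^T(\overline\mu_i-\underline\mu_i)+\overline\nu_i-\underline\nu_i$ for some convex coefficients $\hat\gamma_k\ge0$, $\sum_k\hat\gamma_k=1$ (depending on $i$), with $N_k(u_i)$ the associated matrices for capacity $E_i$. The prices are $\Theta_j=\lambda+\underline\eta_j-\overline\eta_j$ for generator $j$ (paid $\Theta_j^Tg_j$) and $\theta_i$ for storage $i$ (paid $\theta_i^T\nu_i$). **Competitive equilibrium.**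 Participants are price-taking. The bids form a competitive equilibrium if: (1) for each $j$, $\alpha_j$ maximizes over $\alpha\ge0$ the profit $\alpha\,\Theta_j^T\Theta_j-\frac{c_j}{2}\alpha^2\Theta_j^T\Theta_j$; (2) for each $i$, $\beta_i$ maximizes over $\beta\ge0$ the profit $\beta\,\theta_i^T\theta_i-\frac{b_i}{2}\beta^2\theta_i^T\theta_i$; (3) for each $i$, the Rainflow constraint is satisfied with per-cycle prices $\theta_i$; (4) the demand $d$ is satisfied with the market-clearing prices $\lambda$; here dispatch and prices are an optimal solution and dual variables of the market-clearing problem for these bids. *)

(* Defs.v *)
From HB Require Import structures.
From mathcomp Require Import all_boot all_order all_algebra.
From mathcomp Require Import boolp classical_sets reals topology normedtype.

Set Implicit Arguments.
Unset Strict Implicit.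
Unset Printing Implicit Defensive.

Import Order.TTheory GRing.Theory Num.Theory.
Import numFieldNormedType.Exports.
Local Open Scope classical_set_scope.
Local Open Scope ring_scope.

(* Rainflow counting.  Points are indices i : I with value x i; a half-cycle is
   a pair of indices, stored as (high, low) once recorded. *)
Section Counting.
Context {R : realDomainType} {I : Type} (x : I -> R).

(* Removes every point whose value equals that of the last point kept. *)
Fixpoint merge_from (p : I) (s : seq I) : seq I :=
  if s is q :: s' then
    if x q == x p then merge_from p s' else q :: merge_from q s'
  else [::].

Definition merge_plateaus (s : seq I) : seq I :=
  if s is p :: s' then p :: merge_from p s' else [::].

Definition local_extremum (p q r : I) : bool :=
  (x p < x q) && (x r < x q) || (x q < x p) && (x q < x r).

(* p is the left neighbour of the head of s; the last point is always kept. *)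
Fixpoint turning_from (p : I) (s : seq I) : seq I :=
  if s is q :: s' then
    if s' is r :: _ then
      if local_extremum p q r then q :: turning_from q s' else turning_from q s'
    else [:: q]
  else [::].

Definition turning_points (s : seq I) : seq I :=
  if merge_plateaus s is p :: s' then p :: turning_from p s' else [::].

Definition depth (c : I * I) : R := `|x c.1 - x c.2|.

Definition orient (c : I * I) : I * I :=
  if x c.2 < x c.1 then c else (c.2, c.1).

(* The middle pair of the leftmost extractable quadruple, together with the
   points that remain after deleting it. *)
Fixpoint extract (s : seq I) : option ((I * I) * seq I) :=
  if s is p :: s1 then
    if s1 is [:: q, r, w & s2] then
      if (depth (q, r) <= depth (p, q)) && (depth (q, r) <= depth (r, w))
      then Some ((q, r), [:: p, w & s2])
      else if extract s1 is Some (c, s') then Some (c, p :: s') else None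
    else None
  else None.

Definition residual_cycles (s : seq I) : seq (I * I) :=
  if s is p :: s' then [seq orient c | c <- zip (p :: s') s'] else [::].

(* Each extraction deletes two points, so [size s] is enough fuel. *)
Fixpoint count_cycles (fuel : nat) (s : seq I) : seq (I * I) :=
  if extract s is Some (c, s') then
    if fuel is fuel'.+1
    then [:: orient c, orient c & count_cycles fuel' s'] else [::]
  else residual_cycles s.

(* [sort] is stable, so ties stay in order of extraction. *)
Definition half_cycles (s : seq I) : seq (I * I) :=
  sort (fun c c' => depth c' <= depth c) (count_cycles (size s) (turning_points s)).

End Counting.

Section Incidence.
Context {R : realType} {T : nat}.
Implicit Types (x : 'cV[R]_T.+1) (u : 'cV[R]_T) (E : R).

Definition profile_cycles x : seq ('I_T.+1 * 'I_T.+1) :=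
  half_cycles (fun i => x i ord0) (enum 'I_T.+1).

Definition rainflow x : 'cV[R]_T :=
  \col_k nth 0 [seq depth (fun i => x i ord0) c | c <- profile_cycles x] k.

(* The default value 0 of [nth] provides the zero padding. *)
Definition incidence x : 'M[R]_(T.+1, T) :=
  \matrix_(i, k)
    nth 0 [seq (i == c.1)%:R - (i == c.2)%:R | c <- profile_cycles x] k.

(* Row t : 'I_T stands for time t + 1, columns for the times 0, ..., T. *)
Definition diff_mx : 'M[R]_(T, T.+1) :=
  \matrix_(t, s) ((s == t.+1 :> nat)%:R - (s == t :> nat)%:R).

Definition moore_penrose m n (A : 'M[R]_(m, n)) (X : 'M[R]_(n, m)) : Prop :=
  [/\ A *m X *m A = A, X *m A *m X = X,
      (A *m X)^T = A *m X & (X *m A)^T = X *m A].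

Definition pinv m n (A : 'M[R]_(m, n)) : 'M[R]_(n, m) :=
  xget 0 [set X | moore_penrose A X].

(* The profile of u that starts at 0; [incidence] does not depend on this
   choice of the initial value. *)
Definition soc_profile E u : 'cV[R]_T.+1 :=
  \col_i (- E^-1 * \sum_(t < T | (t < i)%N) u t ord0).

Definition rainflow_mx E u : 'M[R]_T :=
  - E^-1 *: ((incidence (soc_profile E u))^T *m pinv diff_mx).

Definition degradation_cost (b E : R) u : R :=
  b / 2 * (u^T *m (rainflow_mx E u)^T *m rainflow_mx E u *m u) ord0 ord0.

Definition associated E u : set 'M[R]_T :=
  [set N | exists v : nat -> 'cV[R]_T,
    [/\ v n @[n --> \oo] --> u,
        forall n, \forall w \near v n, rainflow_mx E w = rainflow_mx E (v n)
      & rainflow_mx E (v n) @[n --> \oo] --> N]].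

(* [associated E u] is finite; Nk enumerates its elements without repetition. *)
Definition associated_comb E u (theta w : 'cV[R]_T) : Prop :=
  exists (m : nat) (Nk : 'I_m -> 'M[R]_T) (gamma : 'I_m -> R),
    [/\ injective Nk, range Nk = associated E u,
        forall k, 0 <= gamma k, \sum_k gamma k = 1
      & w = \sum_k gamma k *: ((Nk k)^T *m theta)].

End Incidence.

Section Facts.
Context {R : realType}.

Lemma moore_penrose_uniq m n (A : 'M[R]_(m, n)) X Y :
  moore_penrose A X -> moore_penrose A Y -> X = Y.
Proof.
move=> [AXA XAX sAX sXA] [AYA YAY sAY sYA].
have AXY : A *m X = A *m Y.
  by rewrite -[LHS]sAX -{1}AYA -mulmxA trmx_mul sAX sAY mulmxA AXA.
have XAY : X *m A = Y *m A.
  by rewrite -[LHS]sXA -{1}AYA -mulmxA mulmxA trmx_mul sXA trmx_mul -trmx_mul sYA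
     -mulmxA [A *m (X *m A)]mulmxA AXA.
by rewrite -XAX -mulmxA AXY mulmxA XAY YAY.
Qed.

Lemma pinvE m n (A : 'M[R]_(m, n)) X : moore_penrose A X -> pinv A = X.
Proof.
move=> AX; apply: xget_unique => // Y AY; exact: moore_penrose_uniq AY AX.
Qed.

Context {T : nat}.
Implicit Types (x : 'cV[R]_T.+1) (u : 'cV[R]_T) (E : R).

Definition cumsum_mx : 'M[R]_(T.+1, T) := \matrix_(i, t) (t < i)%N%:R.

Lemma soc_profileE E u : soc_profile E u = - E^-1 *: (cumsum_mx *m u).
Proof.
apply/matrixP => i j; rewrite (ord1 j) !mxE; congr (_ * _).
rewrite big_mkcond /=; apply: eq_bigr => t _; rewrite !mxE.
by case: (t < i)%N; rewrite ?mul1r ?mul0r.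
Qed.

Lemma diff_mxE n (B : 'M[R]_(T.+1, n)) (t : 'I_T) j :
  (diff_mx *m B) t j = B (lift ord0 t) j - B (widen_ord (leqnSn T) t) j.
Proof.
rewrite mxE; under eq_bigr do rewrite mxE mulrBl.
rewrite big_split /= (bigD1 (lift ord0 t)) //= [X in _ + _ + X](bigD1 (widen_ord (leqnSn T) t)) //=.
rewrite !eqxx !mul1r !big1 ?addr0 ?oppr0 //.
- by move=> i; rewrite -val_eqE /= => /negPf ->; rewrite mul0r oppr0.
- by move=> i; rewrite -val_eqE /= /bump leq0n add1n => /negPf ->; rewrite mul0r.
Qed.

Lemma diff_cumsum : diff_mx *m cumsum_mx = 1%:M.
Proof.
apply/matrixP => t s; rewrite diff_mxE !mxE /= /bump leq0n add1n ltnS -val_eqE /=.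
by case: ltngtP => //=; rewrite ?subrr ?subr0.
Qed.

Lemma soc_profileP E u : diff_mx *m soc_profile E u = - E^-1 *: u.
Proof. by rewrite soc_profileE -scalemxAr mulmxA diff_cumsum mul1mx. Qed.

Lemma moore_penrose_diff_mx :
  moore_penrose diff_mx
    ((1%:M - const_mx T.+1%:R^-1) *m cumsum_mx).
Proof.
set J : 'M[R]_T.+1 := const_mx _; set K : 'M[R]_T.+1 := 1%:M - J.
have n0 : T.+1%:R != 0 :> R by rewrite pnatr_eq0.
have AJ : diff_mx *m J = 0 :> 'M_(T, T.+1).
  by apply/matrixP => t s; rewrite diff_mxE !mxE subrr.
have AK : diff_mx *m K = diff_mx by rewrite mulmxBr AJ subr0 mulmx1.
have BA : cumsum_mx *m diff_mx = 1%:M - \matrix_(i, j) (j == ord0)%:R.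
  apply/matrixP => i j; rewrite [RHS]mxE [in RHS]mxE [in RHS]mxE [in RHS]mxE.
  transitivity (\sum_(0 <= t < T) (t < i)%N%:R
      * ((j == t.+1 :> nat)%:R - (j == t :> nat)%:R) : R).
    by rewrite mxE big_mkord; apply: eq_bigr => t _; rewrite !mxE.
  have iT : (i <= T)%N by rewrite -ltnS.
  rewrite (big_cat_nat _ (n := i)) //= [X in _ + X = _](_ : _ = 0); last first.
    rewrite big_nat_cond big1 // => t /andP[/andP[it _] _].
    by rewrite ltnNge it mul0r.
  rewrite addr0 (@eq_big_nat _ _ _ 0 i _
      (fun t => (j == t.+1 :> nat)%:R - (j == t :> nat)%:R)); last first.
    by move=> t /andP[_ ti]; rewrite ti mul1r.
  by rewrite telescope_sumr // -!val_eqE /= [in RHS]eq_sym.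
have KE : K *m (\matrix_(i, j) (j == ord0)%:R : 'M_T.+1) = 0.
  rewrite [LHS]mulmxBl mul1mx; apply/matrixP => i j; rewrite !mxE.
  under eq_bigr do rewrite !mxE.
  by rewrite sumr_const card_ord -[X in _ - X]mulr_natl mulrA divff // mul1r subrr.
have XA : K *m cumsum_mx *m diff_mx = K.
  by rewrite -mulmxA BA mulmxBr mulmx1 KE subr0.
have AX : diff_mx *m (K *m cumsum_mx) = 1%:M by rewrite mulmxA AK diff_cumsum.
have KK : K *m K = K.
  by rewrite -{1}XA -mulmxA AK XA.
split; rewrite ?AX ?XA ?mul1mx ?trmx1 //.
- by rewrite mulmxA KK.
- by rewrite linearB /= trmx1 trmx_const.
Qed.

Lemma size_profile_cycles x : (size (profile_cycles x) <= T)%N.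
Proof.
rewrite size_sort; set y := fun i => x i ord0; set s := turning_points _ _.
have mergeS p s' : (size (merge_from y p s') <= size s')%N.
  by elim: s' p => //= q s' IHs p; case: ifP => _ /=; rewrite ?ltnS ?leqW.
have turnS p s' : (size (turning_from y p s') <= size s')%N.
  elim: s' p => //= q [|r s'] IHs p //.
  by case: ifP => _; [rewrite ltnS|apply: leqW]; exact: IHs.
have sT : ((size s).-1 <= T)%N.
  rewrite /s /turning_points; have := size_enum_ord T.+1.
  case: (enum _) => //= p s' [sT]; apply: leq_trans (turnS _ _) _.
  by apply: leq_trans (mergeS _ _) _; rewrite sT.
have extractS s1 c s2 : extract y s1 = Some (c, s2) ->
    size s1 = (size s2).+2 /\ (0 < size s2)%N.
  elim: s1 c s2 => //= p [|q [|r [|w s1]]] // IHs c s2.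
  case: ifP => _; first by case=> _ <-.
  by case E: extract => [[c' s3]|] // [_ <-]; have [-> ?] := IHs _ _ E.
apply: leq_trans sT; elim: (size _) s => [|n IHn] s' /=.
- case: extract => [[]|] //.
  by case: s' => //= p s'; rewrite size_map size_zip /= geq_minr.
- case E: extract => [[c s2]|] /=.
    by have [-> s2_gt0] := extractS _ _ _ E; rewrite /= -[(size s2)]prednK // !ltnS IHn.
  by case: s' {E} => //= p s'; rewrite size_map size_zip /= geq_minr.
Qed.

Lemma depth_orient (x : 'I_T.+1 -> R) c :
  depth x (orient x c) = x (orient x c).1 - x (orient x c).2.
Proof.
rewrite /depth /orient; case: ltP => h /=; rewrite ger0_norm // subr_ge0 //.
exact: ltW.
Qed.

Lemma depth_cycles x c : c \in profile_cycles x ->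
  depth (fun i => x i ord0) c = x c.1 ord0 - x c.2 ord0.
Proof.
rewrite mem_sort; set y := fun i => x i ord0.
move: (turning_points _ _) => s; elim: (size _) s c => [|n IHn] s c /=.
  case: extract => [[c' s']|] //; case: s => //= p s /mapP[e _ ->].
  exact: (depth_orient y).
case: extract => [[c' s']|].
  by rewrite !inE => /or3P[/eqP->|/eqP->|/IHn//]; exact: (depth_orient y).
by case: s => //= p s /mapP[e _ ->]; exact: (depth_orient y).
Qed.

Lemma incidence_rainflow x : (incidence x)^T *m x = rainflow x.
Proof.
apply/matrixP => k j; rewrite !mxE ord1.
under eq_bigr do rewrite !mxE.
have [sk|ks] := leqP (size (profile_cycles x)) k.
  rewrite [RHS]nth_default ?size_map // big1 // => i _.
  by rewrite nth_default ?size_map // mul0r.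
under eq_bigr do rewrite (nth_map (ord0, ord0)) //.
rewrite (nth_map (ord0, ord0)) // depth_cycles ?mem_nth //.
move: (nth _ _ _) => [p q] /=; under eq_bigr do rewrite mulrBl.
rewrite big_split /= (bigD1 p) //= [X in _ + X](bigD1 q) //= !eqxx !mul1r.
by rewrite !big1 ?addr0 // => i /negPf ->; rewrite mul0r ?oppr0.
Qed.

Lemma incidence_const x (n : nat) (a : R) :
  (incidence x)^T *m (const_mx a : 'M_(T.+1, n)) = 0.
Proof.
apply/matrixP => k j; rewrite !mxE; under eq_bigr do rewrite !mxE.
rewrite -mulr_suml.
have [sk|ks] := leqP (size (profile_cycles x)) k.
  by rewrite big1 ?mul0r // => i _; rewrite nth_default ?size_map.
under eq_bigr do rewrite (nth_map (ord0, ord0)) //.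
move: (nth _ _ _) => [p q] /=.
rewrite big_split /= (bigD1 p) //= [X in _ + X](bigD1 q) //= !eqxx.
rewrite !big1 ?addr0; first by rewrite subrr mul0r.
- by move=> i /negPf ->; rewrite oppr0.
- by move=> i /negPf ->.
Qed.

Lemma rainflow_mxP E u : rainflow_mx E u *m u = rainflow (soc_profile E u).
Proof.
rewrite -incidence_rainflow /rainflow_mx (pinvE moore_penrose_diff_mx).
rewrite {3}soc_profileE -scalemxAl -scalemxAr; congr (_ *: _).
rewrite -!mulmxA mulmxBl mul1mx mulmxBr [X in _ - X]mulmxA incidence_const.
by rewrite mul0mx subr0.
Qed.

End Facts.

Section Market.
Context {R : realType} {T : nat} {G S : finType}.

Definition dotv (v w : 'cV[R]_T) : R := (v^T *m w) ord0 ord0.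

Definition lev (v w : 'cV[R]_T) : Prop := forall t, v t ord0 <= w t ord0.

Definition cst (a : R) : 'cV[R]_T := const_mx a.

Definition compl (mu slack : 'cV[R]_T) : Prop :=
  forall t, mu t ord0 * slack t ord0 = 0.

Definition cumul_mx (E : R) : 'M[R]_T :=
  E^-1 *: \matrix_(s, t) (t <= s)%:R.

End Market.

Record market (R : realType) (T : nat) (G S : finType) := Market {
  demand : 'cV[R]_T;
  gcost : G -> R;
  glo : G -> R;
  ghi : G -> R;
  cap : S -> R;
  bcost : S -> R;
  ulo : S -> R;
  uhi : S -> R;
  soc0 : R;
  gcost_gt0 : forall j, 0 < gcost j;
  glo_le : forall j, glo j <= ghi j;
  cap_gt0 : forall i, 0 < cap i;
  bcost_gt0 : forall i, 0 < bcost i;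
  ulo_le : forall i, ulo i <= uhi i;
  soc0_ge0 : 0 <= soc0;
  soc0_le1 : soc0 <= 1
}.

Record dispatch (R : realType) (T : nat) (G S : finType) := Dispatch {
  gen : G -> 'cV[R]_T;
  sto : S -> 'cV[R]_T;
  dep : S -> 'cV[R]_T
}.

Record duals (R : realType) (T : nat) (G S : finType) := Duals {
  lam : 'cV[R]_T;
  theta : S -> 'cV[R]_T;
  eta_lo : G -> 'cV[R]_T;
  eta_hi : G -> 'cV[R]_T;
  rate_lo : S -> 'cV[R]_T;
  rate_hi : S -> 'cV[R]_T;
  mu_lo : S -> 'cV[R]_T;
  mu_hi : S -> 'cV[R]_T;
  delta : S -> R
}.

Section Equilibrium.
Context {R : realType} {T : nat} {G S : finType}.
Variable M : market R T G S.
Implicit Types (g : G -> 'cV[R]_T) (u : S -> 'cV[R]_T).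
Implicit Types (D : dispatch R T G S) (P : duals R T G S).
Implicit Types (alpha : G -> R) (beta : S -> R).

Definition physical_feasible g u : Prop :=
  [/\ demand M = \sum_j g j + \sum_i u i,
      forall j, lev (cst (glo M j)) (g j) /\ lev (g j) (cst (ghi M j)),
      forall i, lev (cst (ulo M i)) (u i) /\ lev (u i) (cst (uhi M i)),
      forall i, dotv (cst 1) (u i) = 0
    & forall i, lev (cst (soc0 M - 1)) (cumul_mx (cap M i) *m u i)
             /\ lev (cumul_mx (cap M i) *m u i) (cst (soc0 M))].

Definition social_cost g u : R :=
  \sum_i degradation_cost (bcost M i) (cap M i) (u i)
  + \sum_j gcost M j / 2 * dotv (g j) (g j).

Definition solves_social_planner g u : Prop :=
  physical_feasible g u /\
  forall g' u', physical_feasible g' u' -> social_cost g u <= social_cost g' u'.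

(* A zero bid forces zero dispatch; the corresponding cost term then vanishes,
   also because 1 / 0 = 0. *)
Definition market_feasible alpha beta D : Prop :=
  [/\ physical_feasible (gen D) (sto D),
      forall i, dep D i = rainflow_mx (cap M i) (sto D i) *m sto D i,
      forall j, alpha j = 0 -> gen D j = 0
    & forall i, beta i = 0 -> dep D i = 0].

Definition market_cost alpha beta D : R :=
  \sum_i 1 / (2 * beta i) * dotv (dep D i) (dep D i)
  + \sum_j 1 / (2 * alpha j) * dotv (gen D j) (gen D j).

Definition clears_market alpha beta D : Prop :=
  market_feasible alpha beta D /\
  forall D', market_feasible alpha beta D' ->
    market_cost alpha beta D <= market_cost alpha beta D'.

Definition dual_feasible P : Prop :=
  (forall j, lev 0 (eta_lo P j) /\ lev 0 (eta_hi P j)) /\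
  (forall i, [/\ lev 0 (rate_lo P i), lev 0 (rate_hi P i),
                 lev 0 (mu_lo P i) & lev 0 (mu_hi P i)]).

Definition complementary_slackness D P : Prop :=
  (forall j, compl (eta_lo P j) (gen D j - cst (glo M j)) /\
             compl (eta_hi P j) (cst (ghi M j) - gen D j)) /\
  (forall i, let Au := cumul_mx (cap M i) *m sto D i in
     [/\ compl (rate_lo P i) (sto D i - cst (ulo M i)),
         compl (rate_hi P i) (cst (uhi M i) - sto D i),
         compl (mu_lo P i) (Au - cst (soc0 M - 1))
       & compl (mu_hi P i) (cst (soc0 M) - Au)]).

(* The two conditions that divide by a bid are void for a zero bid, where the
   variable they are dual to is fixed at zero. *)
Definition stationarity alpha beta D P : Prop :=
  [/\ forall j, 0 < alpha j ->
        lam P = (alpha j)^-1 *: gen D j + eta_hi P j - eta_lo P j,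
      forall i, 0 < beta i -> theta P i = (beta i)^-1 *: dep D i
    & forall i, exists2 w, associated_comb (cap M i) (sto D i) (theta P i) w &
        lam P = w + cst (delta P i)
              + (cumul_mx (cap M i))^T *m (mu_hi P i - mu_lo P i)
              + rate_hi P i - rate_lo P i].

Definition gen_price P (j : G) : 'cV[R]_T := lam P + eta_lo P j - eta_hi P j.

(* Price-taking profit of a participant with cost coefficient k that bids a at
   price p: the revenue is p^T (a p), the cost k / 2 |a p|^2. *)
Definition profit (k : R) (p : 'cV[R]_T) (a : R) : R :=
  a * dotv p p - k / 2 * a ^+ 2 * dotv p p.

Definition best_bid (k : R) (p : 'cV[R]_T) (a : R) : Prop :=
  0 <= a /\ forall a', 0 <= a' -> profit k p a' <= profit k p a.

Definition competitive_equilibrium alpha beta D P : Prop :=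
  [/\ [/\ clears_market alpha beta D, dual_feasible P,
          complementary_slackness D P & stationarity alpha beta D P],
      forall j, best_bid (gcost M j) (gen_price P j) (alpha j),
      forall i, best_bid (bcost M i) (theta P i) (beta i),
      forall i, beta i *: theta P i
                = rainflow_mx (cap M i) (sto D i) *m sto D i
    & demand M = \sum_j alpha j *: gen_price P j + \sum_i sto D i].

End Equilibrium.

(* Main.v *)
Require Import Defs.
From mathcomp Require Import all_boot all_order all_algebra.
From mathcomp Require Import reals.
From mathcomp Require Import boolp classical_sets topology normedtype.
From mathcomp Require Import ring lra.

(** In equilibrium every participant is paid its marginal cost, so the
    stationarity and complementary slackness conditions of the market are the
    Karush-Kuhn-Tucker conditions of the planner.  These are sufficient for
    optimality because the planner problem is convex.  All the work is in the
    convexity of the degradation cost, and in showing that the associated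
    matrices give subgradients of it.

    Convexity.  Up to a factor, the degradation cost is the sum of the squares
    of the half-cycle depths.  For a threshold [2 * k], the sum over all
    half-cycles of the part of the depth above [2 * k] is the truncated
    variation of the profile: the best profit of a trader who may hold one unit,
    nothing, or owe one unit of an asset whose price follows the profile, and
    who pays a fee [k] per traded unit ([excess_half_cycles]).  Computed
    backwards in time, a price acts on the value of holding a unit and on the
    cost of owing one by clipping both to the interval from [x - k] to [x + k].
    This makes visible that merging plateaus and dropping monotone points change
    nothing ([step_between]), that extracting a pair costs exactly the excess of
    its two half-cycles ([step_cycle]), and that the swings of the residue,
    whose depths first increase and then decrease, contribute independently
    ([step_first], [step_last]).  The truncated variation is a maximum of affine
    functions of the profile, hence convex and continuous.  On a finite set of
    nonnegative numbers the square is a nonnegative combination of such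
    thresholded parts ([sqr_hinges]), hence the sum of squared depths is convex
    as well ([dotv_depths_convex]).

    Subgradients.  Where the rainflow matrix is locally constant, the cost is a
    quadratic form, and convexity puts its tangent below the cost everywhere.
    This inequality passes to the limits that define the associated matrices
    ([associated_subgradient]).  An associated matrix [N] at [u] satisfies
    [N *m u = rainflow_mx E u *m u], as the depths depend continuously on [u]:
    they are sorted, and their thresholded sums are truncated variations
    ([associated_depths]).

    Equilibrium.  A best bid is the inverse of the cost coefficient unless the
    price vanishes, and then the dispatched quantity vanishes too; in all cases
    the price is the cost coefficient times that quantity ([marginal_gen_cost],
    [cycle_price]).  Adding up the subgradient inequalities, all multiplier
    terms have the right sign and the power balance cancels the terms in
    [lam P]. *)

Set Implicit Arguments.
Unset Strict Implicit.
Unset Printing Implicit Defensive.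

Import Order.TTheory GRing.Theory Num.Theory.
Import numFieldNormedType.Exports.
Local Open Scope classical_set_scope.
Local Open Scope ring_scope.

(** * A trader with fees *)

Definition relu {R : realFieldType} (v : R) : R := Num.max v 0.

(** The optimal future profit of a trader who may hold one unit, nothing, or owe
    one unit, stored through its marginal values: [flat] when holding nothing,
    [flat + bid] when holding a unit, [flat - ask] when owing a unit.  In these
    coordinates a change of price acts on [bid] and [ask] separately. *)
Record value (R : realFieldType) := Value { flat : R; bid : R; ask : R }.
Arguments Value {R}.
Arguments flat {R}.
Arguments bid {R}.
Arguments ask {R}.

Section TruncatedVariation.
Context {R : realFieldType} (k : R).
Implicit Types (x y p q r c : R) (v : value R).

Definition clip x d : R := Num.max (Num.min d (x + k)) (x - k).

Definition overshoot x d : R := relu (d - (x + k)).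
Definition undershoot x d : R := relu (x - k - d).

(** At price [x] a unit is bought when it is worth more than [x + k], and sold
    when the cost of owing it is less than [x - k]; the surplus goes to [flat].
    After that possibility a held unit is worth at least its resale price
    [x - k] and at most its replacement price [x + k], whence the clipping. *)
Definition step x v : value R :=
  Value (flat v + overshoot x (bid v) + undershoot x (ask v))
        (clip x (bid v)) (clip x (ask v)).

(** At the last price every position has to be closed. *)
Definition terminal x : value R := Value 0 (x - k) (x + k).

Fixpoint value_of x (s : seq R) : value R :=
  if s is y :: s' then step x (value_of y s') else terminal x.

(** The best profit along the prices [s] for trading fee [k] per unit.  A round
    trip pays the fee twice, so that a rise or a fall of height [a] taken alone
    earns [a - 2 * k]. *)
Definition truncated_variation (s : seq R) : R :=
  if s is x :: s' then flat (value_of x s') else 0.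

(** The states that can arise at price [x]. *)
Definition near_price x v : Prop :=
  [/\ x - k <= bid v, bid v <= ask v & ask v <= x + k].

Definition add_flat c v : value R := Value (flat v + c) (bid v) (ask v).

Definition between p q r : bool := (p <= q <= r) || (r <= q <= p).

Variant clip_spec x d : R -> R -> R -> Type :=
| ClipLow of d < x - k : clip_spec x d (x - k) 0 (x - k - d)
| ClipMid of x - k <= d & d <= x + k : clip_spec x d d 0 0
| ClipHigh of x + k < d : clip_spec x d (x + k) (d - (x + k)) 0.

Hypothesis k_ge0 : 0 <= k.

Lemma clipP x d :
  clip_spec x d (clip x d) (relu (d - (x + k))) (relu (x - k - d)).
Proof.
have k0 := k_ge0; rewrite /clip /relu.
have [dhi|hid] := leP d (x + k); last first.
  rewrite [Num.max (x + k) _]max_l ?[Num.max (d - _) _]max_l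
    ?[Num.max (x - k - d) _]max_r; [by constructor|..]; lra.
have [lod|dlo] := leP (x - k) d.
  by rewrite [Num.max (d - _) _]max_r ?[Num.max (x - k - d) _]max_r;
    [constructor|..]; lra.
by rewrite [Num.max (d - _) _]max_r ?[Num.max (x - k - d) _]max_l;
  [constructor|..]; lra.
Qed.

Variant relu_spec (d : R) : R -> Type :=
| ReluNeg of d <= 0 : relu_spec d 0
| ReluPos of 0 < d : relu_spec d d.

Lemma reluP (d : R) : relu_spec d (relu d).
Proof. by rewrite /relu; case: leP => h; constructor. Qed.

Lemma near_price_step x v : bid v <= ask v -> near_price x (step x v).
Proof.
have k0 := k_ge0; rewrite /near_price /=.
by case: (clipP x (bid v)); case: (clipP x (ask v)); split; lra.
Qed.

Lemma near_price_value x (s : seq R) : near_price x (value_of x s).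
Proof.
have k0 := k_ge0; elim: s x => [|y s IHs] x /=; first by split => /=; lra.
by apply: near_price_step; have [] := IHs y.
Qed.

Lemma step_id x v : near_price x v -> step x v = v.
Proof.
have k0 := k_ge0; case: v => f b a [/= ? ? ?]; rewrite /step /overshoot /undershoot /=.
by case: (clipP x b) => *; case: (clipP x a) => *; congr Value; lra.
Qed.

Lemma step_add p c v : step p (add_flat c v) = add_flat c (step p v).
Proof. by rewrite /step /add_flat /=; congr Value; lra. Qed.

Lemma stepE x v : step x v =
  Value (flat v + overshoot x (bid v) + undershoot x (ask v))
        (clip x (bid v)) (clip x (ask v)).
Proof. by []. Qed.

Lemma clipN x d : clip (- x) (- d) = - clip x d.
Proof. by have k0 := k_ge0; case: (clipP (- x)); case: (clipP x d); lra. Qed.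

Lemma overshootN x d : overshoot (- x) (- d) = undershoot x d.
Proof. by congr relu; lra. Qed.

Lemma undershootN x d : undershoot (- x) (- d) = overshoot x d.
Proof. by congr relu; lra. Qed.

(** Negating all prices exchanges holding with owing a unit.  This symmetry
    reduces the identities for rising prices and for falling prices to one
    another. *)
Definition opp_value v : value R := Value (flat v) (- ask v) (- bid v).

Lemma opp_valueK v : opp_value (opp_value v) = v.
Proof. by case: v => f b a; rewrite /opp_value /= !opprK. Qed.

Lemma stepN x v : step (- x) (opp_value v) = opp_value (step x v).
Proof. by rewrite !stepE /opp_value /= !clipN overshootN undershootN addrAC. Qed.

Lemma terminalN x : terminal (- x) = opp_value (terminal x).
Proof. by congr Value => /=; lra. Qed.

(** As [step] treats the two marginal values separately, each of its identities
    reduces to one about [clip]. *)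
Lemma clip_between p q r d : r - k <= d <= r + k -> p <= q <= r ->
  [/\ clip p (clip q d) = clip p d,
      overshoot q d + overshoot p (clip q d) = overshoot p d &
      undershoot q d + undershoot p (clip q d) = undershoot p d].
Proof.
have k0 := k_ge0; move=> H1 H2.
rewrite /overshoot /undershoot; case: (clipP q d); do ?move=> ?; try (exfalso; lra);
  case: (clipP p _); do ?move=> ?; try (exfalso; lra);
  do ?(case: (clipP p _); do ?move=> ?; try (exfalso; lra)); split; lra.
Qed.

Lemma clip_cycle p q r (s : R) d : s - k <= d <= s + k ->
  (p <= r <= q) && (q <= s) ->
  [/\ clip p (clip q (clip r d)) = clip p d,
      overshoot r d + overshoot q (clip r d) + overshoot p (clip q (clip r d)) =
        overshoot p d + relu (`|q - r| - 2 * k) &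
      undershoot r d + undershoot q (clip r d) + undershoot p (clip q (clip r d)) =
        undershoot p d + relu (`|q - r| - 2 * k)].
Proof.
have k0 := k_ge0; move=> H1 H2.
rewrite ger0_norm /overshoot /undershoot; last by lra.
case: (clipP r d); do ?move=> ?; try (exfalso; lra);
  case: (clipP q _); do ?move=> ?; try (exfalso; lra);
  do ?(case: (clipP p _); do ?move=> ?; try (exfalso; lra));
  case: reluP; move=> ?; split; lra.
Qed.

Lemma near_priceN x v : near_price x v -> near_price (- x) (opp_value v).
Proof. by case=> *; split=> /=; lra. Qed.

(** Trading at a price that the sequence passes monotonically can be moved to
    one of its neighbours without loss. *)
Lemma step_between p q r v :
  near_price r v -> between p q r -> step p (step q v) = step p v.
Proof.
move=> vr pqr; wlog {pqr} pqr : p q r v vr / p <= q <= r => [th|].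
  case/orP: pqr => [|/andP[rq qp]]; first exact: th.
  have := th (- p) (- q) (- r) _ (near_priceN vr).
  rewrite !lerN2 qp rq !stepN => /(_ isT); exact: (can_inj opp_valueK).
have [rb ba ar] := vr.
have [|Cb Db _] := @clip_between p q r (bid v) _ pqr;
  first by rewrite rb (le_trans ba).
have [|Ca _ Ua] := @clip_between p q r (ask v) _ pqr;
  first by rewrite ar (le_trans rb).
by rewrite !stepE /= Cb Ca; congr Value; rewrite -Db -Ua; lra.
Qed.

(** Between [p] and [s] the excursion from [q] to [r] is the smallest swing.  If
    it is deeper than two fees, whatever position is held can be reversed at [q]
    and restored at [r], which earns the swing twice and costs four fees;
    otherwise trading in it does not pay. *)
Lemma step_cycle p q r (s : R) v : near_price s v ->
  (p <= r <= q) && (q <= s) || (s <= q <= r) && (r <= p) ->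
  step p (step q (step r v)) = add_flat (2 * relu (`|q - r| - 2 * k)) (step p v).
Proof.
move=> vs pqrs.
wlog {pqrs} pqrs : p q r s v vs / (p <= r <= q) && (q <= s) => [th|].
  case/orP: pqrs => [|/andP[/andP[sq qr] rp]]; first exact: th.
  have := th (- p) (- q) (- r) (- s) _ (near_priceN vs).
  rewrite !lerN2 sq qr rp !stepN -opprD normrN => /(_ isT) H.
  apply: (can_inj opp_valueK); exact: H.
have [sb ba as_] := vs.
have [|Cb Db _] := @clip_cycle p q r s (bid v) _ pqrs;
  first by rewrite sb (le_trans ba).
have [|Ca _ Ua] := @clip_cycle p q r s (ask v) _ pqrs;
  first by rewrite as_ (le_trans sb).
by rewrite !stepE /add_flat /= Cb Ca; congr Value; move: Db Ua; lra.
Qed.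

Lemma clip_first p q r d : r - k <= d <= r + k -> q <= p <= r ->
  overshoot p (clip q d) = 0 /\ undershoot p (clip q d) = relu (`|p - q| - 2 * k).
Proof.
have k0 := k_ge0; move=> H1 H2; rewrite ger0_norm /overshoot /undershoot; last by lra.
case: (clipP q d); do ?move=> ?; try (exfalso; lra);
  case: (clipP p _); do ?move=> ?; try (exfalso; lra);
  case: reluP => ?; split; lra.
Qed.

(** The first swing is not larger than the second.  From a flat position it
    earns its own excess and leaves the best strategy from [q] on as it is. *)
Lemma step_first p q r v : near_price r v -> between q p r ->
  flat (step p (step q v)) = flat (step q v) + relu (`|p - q| - 2 * k).
Proof.
move=> vr qpr; wlog {qpr} qpr : p q r v vr / q <= p <= r => [th|].
  case/orP: qpr => [|/andP[rp pq]]; first exact: th.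
  have := th (- p) (- q) (- r) _ (near_priceN vr).
  by rewrite !stepN -opprD normrN !lerN2 pq; apply.
have [rb ba ar] := vr; rewrite [LHS]/= -addrA; congr (_ + _).
have [|-> _] := @clip_first p q r (bid v) _ qpr;
  first by rewrite rb (le_trans ba).
have [|_ ->] := @clip_first p q r (ask v) _ qpr;
  first by rewrite ar (le_trans rb).
by rewrite add0r.
Qed.

Lemma flat_pair p q : flat (step p (terminal q)) = relu (`|p - q| - 2 * k).
Proof.
have k0 := k_ge0; rewrite stepE /= /overshoot /undershoot.
by case: (ger0P (p - q)) => ?; do 3 (case: reluP => ?); lra.
Qed.

(** Counterpart of [step_first] at the other end: dropping the last, not larger
    swing changes the state before it only by a constant. *)
Lemma step_last q r (s : R) : between q s r ->
  step q (step r (terminal s)) =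
  add_flat (relu (`|r - s| - 2 * k)) (step q (terminal r)).
Proof.
have k0 := k_ge0; move=> qsr; wlog {qsr} qsr : q r s / q <= s <= r => [th|].
  case/orP: qsr => [|/andP[rs sq]]; first exact: th.
  have := th (- q) (- r) (- s); rewrite !terminalN !stepN -opprD normrN.
  rewrite !lerN2 sq rs => /(_ isT) H; apply: (can_inj opp_valueK); exact: H.
rewrite -flat_pair !stepE /add_flat /= /overshoot /undershoot.
case: (clipP r (s - k)); do ?move=> ?; try (exfalso; lra);
  case: (clipP r (s + k)); do ?move=> ?; try (exfalso; lra);
  do ?(case: (clipP q _); do ?move=> ?; try (exfalso; lra)); congr Value; lra.
Qed.

End TruncatedVariation.

(** * Rainflow counting and truncated variation *)

Section Rainflow.
Context {R : realFieldType} {I : Type} (k : R) (x : I -> R).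
Hypothesis k_ge0 : 0 <= k.
Implicit Types (p q r : I) (s t : seq I) (c : I * I).

Notation V p s := (value_of k (x p) (map x s)).
Notation TV s := (truncated_variation k (map x s)).

(** A half-cycle that earns less than its two fees counts for nothing. *)
Definition excess c : R := relu (depth x c - 2 * k).

Lemma near_V p s : near_price k (x p) (V p s).
Proof. exact: near_price_value. Qed.

Lemma value_merge_from p s : V p (merge_from x p s) = V p s.
Proof.
elim: s p => [|q s IHs] p //=; case: eqP => [qp|_] /=; last by rewrite IHs.
by rewrite IHs qp step_id //; exact: near_V.
Qed.

Definition no_plateau p s : bool := path (fun a b => x a != x b) p s.

Lemma no_plateau_merge_from p s : no_plateau p (merge_from x p s).
Proof.
elim: s p => [|q s IHs] p //=; case: eqP => [_|/eqP qp] //=.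
by rewrite eq_sym qp /=; exact: IHs.
Qed.

Lemma turning_fromE p q r s : turning_from x p [:: q, r & s] =
  if local_extremum x p q r then q :: turning_from x q (r :: s)
  else turning_from x q (r :: s).
Proof. by []. Qed.

(** Points that are skipped before the next turning point continue the swing in
    its direction. *)
Lemma turning_from_head p q s : no_plateau p (q :: s) ->
  exists r t, turning_from x p (q :: s) = r :: t /\
    (x p < x q -> x q <= x r) /\ (x q < x p -> x r <= x q).
Proof.
elim: s p q => [|r s IHs] p q; first by exists q, [::].
rewrite turning_fromE => /and3P[pq qr rs]; case: ifP => [_|notext].
  by exists q, (turning_from x q (r :: s)).
have [|w [t [-> [up dn]]]] := IHs q r; first by rewrite /no_plateau /= qr.
exists w, t; split => //; move: notext; rewrite /local_extremum.
case: (ltgtP (x p) (x q)) pq => //= pq _;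
  case: (ltgtP (x q) (x r)) qr up dn => //= qr _ up dn _; split=> // _.
- by rewrite (le_trans (ltW qr)) ?up.
- by rewrite (le_trans (dn _)) ?ltW.
Qed.

Lemma value_turning_from p s : no_plateau p s -> V p (turning_from x p s) = V p s.
Proof.
elim: s p => [|q [|r s] IHs] p // /andP[pq qrs].
have {}IHs := IHs q qrs.
rewrite turning_fromE.
case: ifP => [_|notext]; first by rewrite [LHS]/= IHs.
rewrite [RHS]/= -[step _ (x q) _]/(V q (r :: s)) -IHs.
have [w [t [-> [up dn]]]] := turning_from_head qrs.
rewrite [LHS]/= [in RHS]/= (@step_between _ _ _ _ _ (x w)) //; first exact: near_V.
have /andP[qr _] := qrs; move: notext up dn; rewrite /local_extremum /between.
case: (ltgtP (x p) (x q)) pq => //= pq _;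
  case: (ltgtP (x q) (x r)) qr => //= qr _ _ up dn.
- by rewrite (le_trans (ltW qr)) ?up.
- by rewrite (le_trans (dn _)) ?ltW.
Qed.

(** The sequence alternates between rises and falls.  This is what makes the
    test for extraction, which compares depths only, decide the order of the
    four values. *)
Fixpoint zigzag s : bool :=
  if s is p :: s1 then
    (if s1 is [:: q, r & _] then local_extremum x p q r else true) && zigzag s1
  else true.

Lemma zigzagE p q r s :
  zigzag [:: p, q, r & s] = local_extremum x p q r && zigzag [:: q, r & s].
Proof. by []. Qed.

Lemma zigzag_turning_from p s : no_plateau p s -> zigzag (p :: turning_from x p s).
Proof.
elim: s p => [|q [|r s] IHs] p // /andP[pq qrs].
have := IHs q qrs.
rewrite turning_fromE.
have [w [t [-> [up dn]]]] := turning_from_head qrs.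
have /andP[qr _] := qrs.
case: ifP => [ext|notext].
  rewrite [zigzag (q :: _)]/= [zigzag [:: p, q, _ & _]]/= => ->; rewrite andbT.
  move: ext up dn; rewrite /local_extremum.
  case/orP => /andP[pq' qr'] up dn.
  - by rewrite pq' /= (le_lt_trans (dn _)).
  - by rewrite pq' /= orbC (lt_le_trans _ (up _)).
case: t => [|z t] //=; rewrite /local_extremum => /andP[ext ->]; rewrite andbT.
move: notext ext up dn; rewrite /local_extremum.
case: (ltgtP (x p) (x q)) pq => //= pq _;
  case: (ltgtP (x q) (x r)) qr => //= qr _ _ + up dn.
- have qw := lt_le_trans qr (up isT); rewrite qw (lt_trans pq qw) /=.
  by rewrite (lt_gtF qw) /= orbF => ->.
- have qw := le_lt_trans (dn isT) qr; rewrite qw (lt_trans qw pq) /=.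
  by rewrite (lt_gtF qw) /= => ->; rewrite orbT.
Qed.

Lemma zigzag_turning_points s : zigzag (turning_points x s).
Proof.
by case: s => //= p s; apply/zigzag_turning_from/no_plateau_merge_from.
Qed.

Lemma size_turning_points s : (size (turning_points x s) <= size s)%N.
Proof.
have merge_le p t : (size (merge_from x p t) <= size t)%N.
  by elim: t p => //= q t IHt p; case: ifP => _ /=; rewrite ?ltnS ?leqW.
have turn_le p t : (size (turning_from x p t) <= size t)%N.
  elim: t p => // q [//|r t] IHt p; rewrite turning_fromE.
  by case: ifP => _; [rewrite ltnS|apply: leqW]; exact: IHt.
by case: s => //= p s; rewrite ltnS (leq_trans (turn_le _ _)).
Qed.

Lemma truncated_variation_turning_points s : TV (turning_points x s) = TV s.
Proof.
case: s => [//|p s] /=; rewrite value_turning_from ?value_merge_from //.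
exact: no_plateau_merge_from.
Qed.

Lemma extract_order p q r w :
  local_extremum x p q r -> local_extremum x q r w ->
  depth x (q, r) <= depth x (p, q) -> depth x (q, r) <= depth x (r, w) ->
  (x p <= x r < x q) && (x q <= x w) || (x w <= x q < x r) && (x r <= x p).
Proof.
rewrite /local_extremum /depth /=.
case/orP=> /andP[h1 h2]; case/orP=> /andP[h3 h4]; try (exfalso; lra).
- by rewrite (@ger0_norm _ (x q - x r)) ?(@ler0_norm _ (x p - x q))
    ?(@ler0_norm _ (x r - x w)); lra.
- by rewrite (@ler0_norm _ (x q - x r)) ?(@ger0_norm _ (x p - x q))
    ?(@ger0_norm _ (x r - x w)); lra.
Qed.

Lemma extractE p q r w s : extract x [:: p, q, r, w & s] =
  if (depth x (q, r) <= depth x (p, q)) && (depth x (q, r) <= depth x (r, w))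
  then Some ((q, r), [:: p, w & s])
  else if extract x [:: q, r, w & s] is Some (c, s') then Some (c, p :: s') else None.
Proof. by []. Qed.

(** The deleted pair was worth its two half-cycles.  That the first swing keeps
    its direction is what lets the induction conclude that the remaining
    sequence still alternates. *)
Lemma extractP p q s c s' : zigzag [:: p, q & s] ->
  extract x [:: p, q & s] = Some (c, s') ->
  exists q' t, [/\ s' = [:: p, q' & t], size s' = size s, zigzag s' &
    [/\ x p < x q -> x p < x q', x q < x p -> x q' < x p &
    V p (q :: s) = add_flat (2 * excess c) (V p (q' :: t))]].
Proof.
elim: s p q c s' => [//|r [//|w s] IHs] p q c s' zz; rewrite extractE.
have := zz; rewrite !zigzagE => /and3P[pqr qrw zz'].
case: ifP => [/andP[pq_qr qr_rw]|_].
  move=> [<- <-]; exists w, s.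
  have ord := extract_order pqr qrw pq_qr qr_rw.
  split=> //.
    case: s {IHs zz} zz' => [|z s] //; rewrite !zigzagE => /andP[+ ->].
    rewrite andbT.
    rewrite /local_extremum; case/orP: ord => /andP[/andP[h1 h2] h3];
      case/orP => /andP[h4 h5]; try (exfalso; lra).
    - by rewrite h5 (le_lt_trans h1 h4).
    - by rewrite h5 (lt_le_trans h4 h3) orbT.
  split.
  - by case/orP: ord => /andP[/andP[h1 h2] h3] pq; lra.
  - by case/orP: ord => /andP[/andP[h1 h2] h3] pq; lra.
  - rewrite [LHS]/= (@step_cycle _ _ _ _ _ _ (x w)) //; first exact: near_V.
    case/orP: ord => /andP[/andP[h1 h2] h3]; apply/orP; [left|right];
     by apply/andP; split; [apply/andP; split|]; lra.
case E: (extract x [:: q, r, w & s]) => [[c0 s0]|] // [<- <-].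
have [|q' [t [-> sz zz0 [up dn eqV]]]] := IHs q r _ _ _ E; first by rewrite zigzagE qrw.
exists q, (q' :: t); split => //; first by move: sz => /= [->].
- rewrite zigzagE zz0 andbT; move: pqr; rewrite /local_extremum.
  by case/orP => /andP[-> h] /=; [rewrite dn|rewrite up // orbT].
- by split=> //; rewrite -[LHS]/(step k (x p) (V q [:: r, w & s])) eqV step_add.
Qed.

Lemma extract_None p s : extract x (p :: s) = None -> extract x s = None.
Proof.
case: s => [|q [|r [|w s]]] //; rewrite extractE; case: ifP => // _.
by case: (extract x [:: q, r, w & s]) => [[]|].
Qed.

Definition total_excess (cs : seq (I * I)) : R := \sum_(c <- cs) excess c.

Lemma excess_orient c : excess (orient x c) = excess c.
Proof.
by rewrite /excess /orient; case: ifP => //= _; rewrite /depth /= distrC.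
Qed.

Lemma residual_cyclesE p q s :
  total_excess (residual_cycles x [:: p, q & s]) =
  excess (p, q) + total_excess (residual_cycles x (q :: s)).
Proof.
by rewrite /total_excess /= big_cons excess_orient.
Qed.

Lemma between_of_depth p q r : local_extremum x p q r ->
  (depth x (p, q) <= depth x (q, r) -> between (x q) (x p) (x r)) /\
  (depth x (q, r) <= depth x (p, q) -> between (x p) (x r) (x q)).
Proof.
rewrite /local_extremum /between /depth /=; case/orP => /andP[h1 h2].
- rewrite (@ler0_norm _ (x p - x q)) ?(@ger0_norm _ (x q - x r)); [split=> h|..]; lra.
- rewrite (@ger0_norm _ (x p - x q)) ?(@ler0_norm _ (x q - x r)); [split=> h|..]; lra.
Qed.

(** Once two successive swings of the residue decrease, so do all later ones,
    as otherwise a pair could be extracted.  Such a tail is peeled off from its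
    end. *)
Lemma value_decreasing p q r s : zigzag [:: p, q, r & s] ->
  extract x [:: p, q, r & s] = None -> depth x (q, r) <= depth x (p, q) ->
  V p [:: q, r & s] = add_flat (total_excess (residual_cycles x [:: q, r & s]))
                               (step k (x p) (terminal k (x q))).
Proof.
elim: s p q r => [|w s IHs] p q r.
  rewrite [zigzag _]/= !andbT => pqr _ qr_pq.
  rewrite /total_excess /= big_seq1 excess_orient.
  by apply: step_last => //; have [_ h] := between_of_depth pqr; exact: h.
rewrite !zigzagE => /and3P[pqr qrw zz] N qr_pq.
have N' := extract_None N.
have rw_qr : depth x (r, w) <= depth x (q, r).
  by move: N; rewrite extractE qr_pq /=; case: leP => // /ltW.
rewrite -[LHS]/(step k (x p) (V q [:: r, w & s])) IHs //; last first.
  by rewrite zigzagE qrw.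
rewrite step_add step_last //; last by have [_ h] := between_of_depth pqr; exact: h.
by rewrite (residual_cyclesE q r) /add_flat; congr Value; rewrite [RHS]addrA.
Qed.

(** In the residue the depths first increase and then decrease, so a
    shortest swing is always found at one of the two ends. *)
Lemma value_residual p s : zigzag (p :: s) -> extract x (p :: s) = None ->
  TV (p :: s) = total_excess (residual_cycles x (p :: s)).
Proof.
elim: s p => [|q s IHs] p; first by rewrite /total_excess big_nil.
move=> zz N; have N' := extract_None N.
case: s IHs zz N N' => [|r s] IHs zz N N'.
  by rewrite /total_excess /= big_seq1 excess_orient; exact: flat_pair.
have := zz; rewrite zigzagE => /andP[pqr zz'].
have [pq_qr|/ltW qr_pq] := leP (depth x (p, q)) (depth x (q, r)).
  rewrite residual_cyclesE -IHs // [RHS]addrC.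
  apply: step_first => //; first exact: (near_V r s).
  by have [h _] := between_of_depth pqr; exact: h.
rewrite -[LHS]/(flat (V p [:: q, r & s])) value_decreasing //.
by rewrite (residual_cyclesE p q) [excess _](esym (flat_pair k_ge0 _ _)).
Qed.

Lemma total_excess_count_cycles n s : (size s <= n)%N -> zigzag s ->
  total_excess (count_cycles x n s) = TV s.
Proof.
elim: n s => [|n IHn] s; first by case: s => // _ _; rewrite /total_excess big_nil.
move=> sn zz /=; case E: extract => [[c s']|].
  case: s sn zz E => [|p [|q s]] // sn zz E.
  have [q' [t [es' sz zz' [_ _ eqV]]]] := extractP zz E.
  have IH : total_excess (count_cycles x n s') = TV s'.
    by apply: IHn => //; rewrite sz; exact: ltnW.
  rewrite -[RHS]/(flat (V p (q :: s))) eqV /total_excess !big_cons !excess_orient.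
  rewrite [X in _ + (_ + X)]IH es' /add_flat /=; lra.
case: s zz E {sn} => [|p s] zz E; first by rewrite /total_excess big_nil.
by rewrite -value_residual.
Qed.

End Rainflow.

(** Every stage of the counting procedure preserves the truncated variation, up
    to the excess of the half-cycles that it records. *)
Lemma excess_half_cycles {R : realFieldType} {I : eqType} (k : R) (x : I -> R)
    (s : seq I) : 0 <= k ->
  \sum_(c <- half_cycles x s) relu (depth x c - 2 * k) =
    truncated_variation k (map x s).
Proof.
move=> k_ge0; rewrite -truncated_variation_turning_points //.
rewrite (perm_big _ (permEl (perm_sort _ _))) /=.
exact: (total_excess_count_cycles k_ge0 (size_turning_points x s)
  (zigzag_turning_points x s)).
Qed.

(** * Convexity and continuity of the truncated variation *)

(** The optimal profits when holding a unit and when owing a unit.  These and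
    [flat] are maxima over trading plans of functions that are affine in the
    prices, so that convexity and continuity show in these coordinates. *)
Definition long {R : realFieldType} (v : value R) : R := flat v + bid v.
Definition short {R : realFieldType} (v : value R) : R := flat v - ask v.

Ltac split_max := repeat match goal with
  | |- context [Num.max ?a ?b] =>
      lazymatch a with context [Num.max _ _] => fail | _ => idtac end;
      lazymatch b with context [Num.max _ _] => fail | _ => idtac end;
      case: (leP a b) => ?; try (exfalso; lra)
  end.

Section MaxFormulas.
Context {R : realFieldType} (k : R).
Hypothesis k_ge0 : 0 <= k.

Lemma flat_step (x : R) v : bid v <= ask v -> flat (step k x v) =
  Num.max (flat v) (Num.max (long v - (x + k)) (short v + (x - k))).
Proof.
have k0 := k_ge0; case: v => f b a.
rewrite stepE /long /short /overshoot /undershoot /= => ba.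
case: (clipP k_ge0 x b); do ?move=> ?; case: (clipP k_ge0 x a); do ?move=> ?;
  try (exfalso; lra); split_max; lra.
Qed.

Lemma long_step (x : R) v : bid v <= ask v ->
  long (step k x v) = Num.max (long v) (flat (step k x v) + (x - k)).
Proof.
have k0 := k_ge0; case: v => f b a.
rewrite stepE /long /short /overshoot /undershoot /= => ba.
case: (clipP k_ge0 x b); do ?move=> ?; case: (clipP k_ge0 x a); do ?move=> ?;
  try (exfalso; lra); split_max; lra.
Qed.

Lemma short_step (x : R) v : bid v <= ask v ->
  short (step k x v) = Num.max (short v) (flat (step k x v) - (x + k)).
Proof.
have k0 := k_ge0; case: v => f b a.
rewrite stepE /long /short /overshoot /undershoot /= => ba.
case: (clipP k_ge0 x b); do ?move=> ?; case: (clipP k_ge0 x a); do ?move=> ?;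
  try (exfalso; lra); split_max; lra.
Qed.

Lemma max_convex (t a a1 a2 b b1 b2 : R) : 0 <= t <= 1 ->
  a <= (1 - t) * a1 + t * a2 -> b <= (1 - t) * b1 + t * b2 ->
  Num.max a b <= (1 - t) * Num.max a1 b1 + t * Num.max a2 b2.
Proof.
move=> /andP[t0 t1] ha hb; have u0 : 0 <= 1 - t by lra.
have mono c1 c2 d1 d2 : c1 <= d1 -> c2 <= d2 ->
    (1 - t) * c1 + t * c2 <= (1 - t) * d1 + t * d2.
  by move=> h1 h2; apply: lerD; apply: ler_wpM2l.
by rewrite ge_max (le_trans ha) ?(le_trans hb) ?mono // le_max lexx ?orbT.
Qed.

Lemma bid_le_ask (x : R) s : bid (value_of k x s) <= ask (value_of k x s).
Proof. by have [] := near_price_value k_ge0 x s. Qed.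

Lemma truncated_variation_convex {I : Type} (x y : I -> R) (t : R) (s : seq I) :
  0 <= t <= 1 ->
  truncated_variation k [seq (1 - t) * x i + t * y i | i <- s] <=
  (1 - t) * truncated_variation k [seq x i | i <- s] +
  t * truncated_variation k [seq y i | i <- s].
Proof.
move=> t01; case: s => [|p s] /=; first by lra.
set z := fun i => (1 - t) * x i + t * y i.
pose V (w : I -> R) p s := value_of k (w p) (map w s).
pose below (f : value R -> R) q s' :=
  f (V z q s') <= (1 - t) * f (V x q s') + t * f (V y q s').
suff [] : [/\ below flat p s, below long p s & below short p s] by [].
elim: s p => [|q s IHs] p.
  by split; rewrite /below /V /long /short /z /=; lra.
have [Hf Hl Hs] := IHs q.
have VE w : V w p (q :: s) = step k (w p) (V w q s) by [].
have Hf' : below flat p (q :: s).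
  rewrite /below !VE !flat_step ?bid_le_ask //.
  by do 2 (apply: max_convex => //); move: Hf Hl Hs; rewrite /below /z; lra.
split=> //.
- rewrite /below !VE !long_step ?bid_le_ask //; apply: max_convex => //.
  by move: Hf'; rewrite /below !VE /z; lra.
- rewrite /below !VE !short_step ?bid_le_ask //; apply: max_convex => //.
  by move: Hf'; rewrite /below !VE /z; lra.
Qed.

End MaxFormulas.

Lemma truncated_variation_continuous {R : realType} {U : topologicalType}
    {I : Type} (k : R) (x : U -> I -> R) (u : U) (s : seq I) : 0 <= k ->
  (forall i, {for u, continuous (x^~ i : U -> R^o)}) ->
  {for u, continuous (fun w => truncated_variation k (map (x w) s) : R^o)}.
Proof.
move=> k_ge0 cx; case: s => [|p s]; first exact: cst_continuous.
rewrite [X in {for _, continuous X}]/=.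
pose V w p s := value_of k (x w p) (map (x w) s).
pose cont (f : value R -> R) q s' := {for u, continuous (fun w => f (V w q s') : R^o)}.
suff [] : [/\ cont flat p s, cont long p s & cont short p s] by [].
have cstx q (c : R) : {for u, continuous (fun w => x w q + c : R^o)}.
  by apply: cvgD; [exact: cx|exact: cvg_cst].
have cstNx q (c : R) : {for u, continuous (fun w => c - x w q : R^o)}.
  by apply: cvgB; [exact: cvg_cst|exact: cx].
elim: s p => [|q s IHs] p.
  split; rewrite /cont; first exact: cst_continuous.
  - rewrite (_ : (fun _ => _) = fun w => x w p - k); first exact: cstx.
    by apply/funext => w; rewrite /long /= add0r.
  - rewrite (_ : (fun _ => _) = fun w => - k - x w p); first exact: cstNx.
    by apply/funext => w; rewrite /short /= opprD add0r addrC.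
have [Hf Hl Hs] := IHs q.
have VE w : V w p (q :: s) = step k (x w p) (V w q s) by [].
have ba w : bid (V w q s) <= ask (V w q s) by exact: bid_le_ask.
have Hf' : cont flat p (q :: s).
  rewrite /cont (_ : (fun _ => _) = (fun w => flat (V w q s) : R^o) \max
    ((fun w => long (V w q s) - (x w p + k) : R^o) \max
     (fun w => short (V w q s) + (x w p - k) : R^o))).
    apply: continuous_max => //; apply: continuous_max.
    - by apply: cvgB => //; exact: cstx.
    - by apply: cvgD => //; exact: cstx.
  by apply/funext => w; rewrite VE flat_step.
split=> //; rewrite /cont.
- rewrite (_ : (fun _ => _) = (fun w => long (V w q s) : R^o) \max
    (fun w => flat (V w p (q :: s)) + (x w p - k) : R^o)).
    by apply: continuous_max => //; apply: cvgD => //; exact: cstx.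
  by apply/funext => w; rewrite VE long_step.
- rewrite (_ : (fun _ => _) = (fun w => short (V w q s) : R^o) \max
    (fun w => flat (V w p (q :: s)) - (x w p + k) : R^o)).
    by apply: continuous_max => //; apply: cvgB => //; exact: cstx.
  by apply/funext => w; rewrite VE short_step.
Qed.

(** * Squares and hinges *)

Section Squares.
Context {R : realFieldType}.
Implicit Types (m v h : R) (s : seq R).

Lemma relu_ge0 v : 0 <= relu v.
Proof. by rewrite /relu le_max lexx orbT. Qed.

Lemma relu_eq0 v : v <= 0 -> relu v = 0.
Proof. by move=> v0; rewrite /relu max_r. Qed.

Lemma relu_id v : 0 <= v -> relu v = v.
Proof. by move=> v0; rewrite /relu max_l. Qed.

(** The square is interpolated at the points of [s] by a piecewise linear
    function that starts at [m] with slope [slope]: between [m] and the next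
    point [v1] the chord has slope [m + v1], and the difference of successive
    slopes, which is the weight of the hinge at [m], is nonnegative as long as
    the slope on arrival is at most [2 * m]. *)
Lemma sqr_hinges_from m slope s : slope <= 2 * m -> path <=%R m s ->
  exists L : seq (R * R), (forall l, l \in L -> 0 <= l.1 /\ m <= 2 * l.2) /\
    forall v, v \in s ->
      v ^+ 2 = m ^+ 2 + slope * (v - m) +
               \sum_(l <- L) l.1 * relu (v - 2 * l.2).
Proof.
elim: s m slope => [|v1 s IHs] m slope slm; first by exists [::]; split.
move=> /= /andP[mv1 ps].
have [||L [Lpos LE]] := IHs v1 (m + v1) => //; first by lra.
exists ((m + v1 - slope, m / 2) :: L); split=> [l|v].
  rewrite inE => /predU1P[->|/Lpos[? ?]]; last by split=> //; lra.
  by split=> /=; lra.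
have m2 : 2 * (m / 2) = m by rewrite mulrC divfK // pnatr_eq0.
rewrite inE big_cons /= m2 => /predU1P[->|vs].
  rewrite big_seq big1 ?addr0 => [|l /Lpos[_ lv]].
    by rewrite relu_id; [ring|lra].
  by rewrite relu_eq0 ?mulr0 //; lra.
have v1v : v1 <= v by move: (order_path_min le_trans ps) => /allP /(_ _ vs).
by rewrite (LE v vs) relu_id; [ring|lra].
Qed.

Lemma sqr_hinges s : (forall v, v \in s -> 0 <= v) ->
  exists L : seq (R * R), (forall l, l \in L -> 0 <= l.1 /\ 0 <= l.2) /\
    forall v, v \in s -> v ^+ 2 = \sum_(l <- L) l.1 * relu (v - 2 * l.2).
Proof.
move=> s_ge0; have [||L [Lpos LE]] := @sqr_hinges_from 0 0 (sort <=%R s).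
- by rewrite mulr0.
- rewrite path_min_sorted; first exact: (sort_sorted le_total).
  by apply/allP => v; rewrite mem_sort => /s_ge0.
exists L; split=> [l /Lpos[? ?]|v vs]; first by split=> //; lra.
by rewrite LE ?mem_sort // expr0n mul0r !add0r.
Qed.

(** On the finitely many points involved the square is one nonnegative
    combination of hinges, so that an inequality known for all hinges passes to
    it. *)
Lemma sum_sqr_le (a b c : seq R) (t : R) :
  (forall v, v \in a ++ b ++ c -> 0 <= v) ->
  (forall k, 0 <= k -> \sum_(v <- c) relu (v - 2 * k) <=
    (1 - t) * (\sum_(v <- a) relu (v - 2 * k)) +
    t * (\sum_(v <- b) relu (v - 2 * k))) ->
  \sum_(v <- c) v ^+ 2 <=
    (1 - t) * (\sum_(v <- a) v ^+ 2) + t * (\sum_(v <- b) v ^+ 2).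
Proof.
move=> ge0 le_relu; have [L [Lpos LE]] := sqr_hinges ge0.
have sumE s : {subset s <= a ++ b ++ c} ->
    \sum_(v <- s) v ^+ 2 = \sum_(l <- L) l.1 * \sum_(v <- s) relu (v - 2 * l.2).
  move=> sub; under [RHS]eq_bigr do rewrite mulr_sumr.
  by rewrite exchange_big /= big_seq [RHS]big_seq; apply: eq_bigr => v /sub /LE.
rewrite !sumE; try by move=> v vs; rewrite !mem_cat vs ?orbT.
rewrite !mulr_sumr -big_split /= big_seq [leRHS]big_seq.
apply: ler_sum => l /Lpos[l1 l2].
apply: le_trans (ler_wpM2l l1 (le_relu _ l2)) _.
by rewrite mulrDr ![l.1 * (_ * _)]mulrCA.
Qed.

(** At the first index where the two sequences differ, consider the hinge at the
    smaller of the two values.  From there on it vanishes along the sequence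
    that has this value, as it is sorted, but not along the other one. *)
Lemma eq_of_hinges T (a b : 'I_T -> R) :
  (forall i, 0 <= a i) -> (forall i, 0 <= b i) ->
  (forall i j : 'I_T, (i <= j)%N -> a j <= a i) ->
  (forall i j : 'I_T, (i <= j)%N -> b j <= b i) ->
  (forall k, 0 <= k -> \sum_i relu (a i - 2 * k) = \sum_i relu (b i - 2 * k)) ->
  a =1 b.
Proof.
move=> a0 b0 am bm E.
have main (c d : 'I_T -> R) (i : 'I_T) : (forall i, 0 <= d i) ->
    (forall i j : 'I_T, (i <= j)%N -> d j <= d i) ->
    (forall k, 0 <= k -> \sum_i relu (c i - 2 * k) = \sum_i relu (d i - 2 * k)) ->
    (forall j : 'I_T, (j < i)%N -> c j = d j) -> c i <= d i.
  move=> d0 dm Ecd IH; rewrite leNgt; apply/negP => dc.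
  have k0 : 0 <= d i / 2 by rewrite divr_ge0.
  have := Ecd _ k0; rewrite mulrC divfK ?pnatr_eq0 // => /eqP; apply/negP.
  rewrite gt_eqF // (bigD1 i) //= [ltRHS](bigD1 i) //=.
  apply: ltr_leD; first by rewrite subrr relu_eq0 // relu_id; lra.
  apply: ler_sum => j ji; have [/IH->//|ij] := ltnP j i.
  by rewrite relu_eq0 ?relu_ge0 // subr_le0 dm.
move=> i; have [n] := ubnP (i : nat); elim: n i => // n IHn i /ltnSE in_.
have IH (j : 'I_T) : (j < i)%N -> a j = b j.
  by move=> ji; apply: IHn; exact: leq_trans in_.
apply/le_anti/andP; split; first exact: main.
by apply: main => // [k k0|j /IH->//]; rewrite E.
Qed.

Lemma sum_nth_pad T (f : R -> R) s : f 0 = 0 -> (size s <= T)%N ->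
  \sum_(i < T) f (nth 0 s i) = \sum_(v <- s) f v.
Proof.
move=> f0 sT; rewrite (big_nth 0) big_mkord.
rewrite (big_ord_widen _ (fun i => f (nth 0 s i)) sT).
rewrite [RHS]big_mkcond; apply: eq_bigr => i _; case: ltnP => // si.
by rewrite nth_default.
Qed.

End Squares.

(** * Convexity and subgradients of the sum of squared depths *)

Section Dot.
Context {R : realType} {T : nat}.
Implicit Types (u v w : 'cV[R]_T).

Lemma dotvE v w : dotv v w = \sum_i v i ord0 * w i ord0.
Proof. by rewrite /dotv mxE; apply: eq_bigr => i _; rewrite mxE. Qed.

Lemma dotvC v w : dotv v w = dotv w v.
Proof. by rewrite !dotvE; apply: eq_bigr => i _; rewrite mulrC. Qed.

Lemma dotvDr u v w : dotv u (v + w) = dotv u v + dotv u w.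
Proof. by rewrite /dotv mulmxDr mxE. Qed.

Lemma dotvZr c u v : dotv u (c *: v) = c * dotv u v.
Proof. by rewrite /dotv -scalemxAr mxE. Qed.

Lemma dotvNr u v : dotv u (- v) = - dotv u v.
Proof. by rewrite -scaleN1r dotvZr mulN1r. Qed.

Lemma dotvBr u v w : dotv u (v - w) = dotv u v - dotv u w.
Proof. by rewrite dotvDr dotvNr. Qed.

Lemma dotvDl u v w : dotv (v + w) u = dotv v u + dotv w u.
Proof. by rewrite ![dotv _ u]dotvC dotvDr. Qed.

Lemma dotvZl c u v : dotv (c *: v) u = c * dotv v u.
Proof. by rewrite ![dotv _ u]dotvC dotvZr. Qed.

Lemma dotvNl u v : dotv (- v) u = - dotv v u.
Proof. by rewrite ![dotv _ u]dotvC dotvNr. Qed.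

Lemma dotvBl u v w : dotv (v - w) u = dotv v u - dotv w u.
Proof. by rewrite dotvDl dotvNl. Qed.

Lemma dotv_sumr I (s : seq I) (P : pred I) (F : I -> 'cV[R]_T) u :
  dotv u (\sum_(i <- s | P i) F i) = \sum_(i <- s | P i) dotv u (F i).
Proof.
apply: (big_morph (dotv u)) => [v w|]; first exact: dotvDr.
by rewrite /dotv mulmx0 mxE.
Qed.

Lemma dotv_suml I (s : seq I) (P : pred I) (F : I -> 'cV[R]_T) u :
  dotv (\sum_(i <- s | P i) F i) u = \sum_(i <- s | P i) dotv (F i) u.
Proof. by rewrite dotvC dotv_sumr; apply: eq_bigr => i _; rewrite dotvC. Qed.

Lemma dotv_mulmxl (A : 'M[R]_T) v w : dotv (A^T *m v) w = dotv v (A *m w).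
Proof. by rewrite /dotv trmx_mul trmxK mulmxA. Qed.

Lemma dotv_ge0 v : 0 <= dotv v v.
Proof. by rewrite dotvE sumr_ge0 // => i _; rewrite -expr2 sqr_ge0. Qed.

Lemma dotv_eq0 v : dotv v v = 0 -> v = 0.
Proof.
rewrite dotvE => /eqP; rewrite psumr_eq0 => [/allP v0|i _];
  last by rewrite -expr2 sqr_ge0.
apply/matrixP => i j; rewrite ord1 mxE.
by have := v0 i (mem_index_enum _); rewrite /= mulf_eq0 orbb => /eqP.
Qed.

End Dot.

Lemma relu_continuous (R : realType) : continuous (relu : R^o -> R^o).
Proof.
by move=> a; apply: continuous_max; [exact: cvg_id|exact: cst_continuous].
Qed.

Section Depths.
Context {R : realType} {T : nat} (E : R).
Implicit Types (u v w y : 'cV[R]_T) (N : 'M[R]_T).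

Definition depths u : 'cV[R]_T := rainflow_mx E u *m u.

Definition depth_seq u : seq R :=
  [seq depth (fun i => soc_profile E u i ord0) c
     | c <- profile_cycles (soc_profile E u)].

Lemma depthsE u k : depths u k ord0 = nth 0 (depth_seq u) k.
Proof. by rewrite /depths rainflow_mxP mxE. Qed.

Lemma size_depth_seq u : (size (depth_seq u) <= T)%N.
Proof. by rewrite size_map size_profile_cycles. Qed.

Lemma depth_seq_ge0 u a : a \in depth_seq u -> 0 <= a.
Proof. by move=> /mapP[c _ ->]; rewrite normr_ge0. Qed.

Lemma depths_ge0 u k : 0 <= depths u k ord0.
Proof.
rewrite depthsE; have [/(mem_nth 0)/depth_seq_ge0 //|h] := ltnP k (size (depth_seq u)).
by rewrite nth_default.
Qed.

Lemma depths_sorted u (i j : 'I_T) :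
  (i <= j)%N -> depths u j ord0 <= depths u i ord0.
Proof.
move=> ij; have [ju|uj] := ltnP j (size (depth_seq u)); last first.
  by rewrite [leLHS]depthsE (nth_default _ uj) depths_ge0.
rewrite !depthsE; have: sorted >=%R (depth_seq u).
  by rewrite sorted_map; apply: sort_sorted => c c'; exact: le_total.
move=> /(sorted_leq_nth ge_trans lexx 0); apply => //; rewrite inE //.
exact: leq_ltn_trans ju.
Qed.

Definition tv (k : R) u : R :=
  truncated_variation k [seq soc_profile E u i ord0 | i <- enum 'I_T.+1].

Lemma relu_depths k u : 0 <= k -> \sum_(a <- depth_seq u) relu (a - 2 * k) = tv k u.
Proof. by move=> k0; rewrite big_map; exact: excess_half_cycles. Qed.

Lemma sum_relu_depths k u : 0 <= k ->
  \sum_i relu (depths u i ord0 - 2 * k) = tv k u.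
Proof.
move=> k0; rewrite -relu_depths // -(sum_nth_pad _ (size_depth_seq u)).
  by apply: eq_bigr => i _; rewrite depthsE.
by rewrite relu_eq0 //; lra.
Qed.

Lemma dotv_depths u : dotv (depths u) (depths u) = \sum_(a <- depth_seq u) a ^+ 2.
Proof.
rewrite dotvE -(@sum_nth_pad _ T (fun a => a ^+ 2)) ?expr0n ?size_depth_seq //.
by apply: eq_bigr => i _; rewrite depthsE expr2.
Qed.

Lemma dotv_depths_convex (t : R) u w : 0 <= t <= 1 ->
  dotv (depths ((1 - t) *: u + t *: w)) (depths ((1 - t) *: u + t *: w)) <=
    (1 - t) * dotv (depths u) (depths u) + t * dotv (depths w) (depths w).
Proof.
move=> t01; set y := _ + _; rewrite !dotv_depths; apply: sum_sqr_le => [a|k k0].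
  by rewrite !mem_cat => /or3P[]; exact: depth_seq_ge0.
rewrite !relu_depths //.
have := truncated_variation_convex k0 (fun i => soc_profile E u i ord0)
  (fun i => soc_profile E w i ord0) (enum 'I_T.+1) t01.
rewrite (_ : map _ _ = [seq soc_profile E y i ord0 | i <- enum 'I_T.+1]) //.
apply: eq_map => i; rewrite !soc_profileE mulmxDr -!scalemxAr scalerDr.
by rewrite !mxE; ring.
Qed.

(** Near such a point the squared norm of the depths is a quadratic form, and
    the left-hand side is its tangent at [v], which a convex function dominates
    everywhere. *)
Lemma locally_linear_subgradient v y :
  (\forall w \near v, rainflow_mx E w = rainflow_mx E v) ->
  dotv (depths v) (depths v) +
    2 * dotv (depths v) (rainflow_mx E v *m (y - v)) <= dotv (depths y) (depths y).
Proof.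
move=> /nbhs_ballP[e /= e0 He].
have [t /andP[t0 t1] near_t] : exists2 t : R, 0 < t <= 1 &
    forall i j, `|t * (y i j - v i j)| < e.
  (* [B] bounds every entry of [y - v]. *)
  pose B := \sum_i `|y i ord0 - v i ord0|; have B0 : 0 <= B by exact: sumr_ge0.
  have Be : 0 < B + e by lra.
  exists (e / (B + e)); first by rewrite divr_gt0 //= ler_pdivrMr //; lra.
  move=> i j; rewrite ord1 normrM gtr0_norm ?divr_gt0 // mulrAC ltr_pdivrMr //.
  rewrite ltr_pM2l // (@le_lt_trans _ _ B) //; last by lra.
  by rewrite /B (bigD1 i) //= lerDl sumr_ge0.
(* For small [t] the segment from [v] to [y] is still where the matrix is that
   of [v]; the quadratic term in [t] has the favourable sign. *)
set w := (1 - t) *: v + t *: y.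
have wE : w = v + t *: (y - v) by rewrite /w scalerBl scale1r scalerBr addrAC addrA.
have Nw : rainflow_mx E w = rainflow_mx E v.
  apply: He; split=> // i j; rewrite /ball /= wE !mxE opprD addrA subrr sub0r normrN.
  exact: near_t.
have t01 : 0 <= t <= 1 by rewrite ltW.
have /= := dotv_depths_convex v y t01; rewrite -/w.
rewrite [depths w]/depths; set a := dotv (depths v) _.
rewrite Nw wE mulmxDr -scalemxAr -/(depths v).
set d := _ *m (y - v); rewrite dotvDr !dotvDl !dotvZr !dotvZl (dotvC d) -/a => h.
have dd := dotv_ge0 d.
suff : t * (a + 2 * dotv (depths v) d) <= t * dotv (depths y) (depths y).
  by rewrite ler_pM2l.
have : 0 <= t * (t * dotv d d) by rewrite !mulr_ge0 ?(ltW t0).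
move: h; lra.
Qed.

Lemma mulmx_cvg (Nn : nat -> 'M[R]_T) (vn : nat -> 'cV[R]_T) N v i :
  Nn n @[n --> \oo] --> N -> vn n @[n --> \oo] --> v ->
  ((Nn n *m vn n) i ord0 : R^o) @[n --> \oo] --> (N *m v) i ord0.
Proof.
move=> cN cv; rewrite mxE; under eq_fun do rewrite mxE.
apply: cvg_big => [|j _]; first exact: add_continuous.
apply: cvgM.
- exact: (continuous_cvg _ (@coord_continuous R T T i j N) cN).
- exact: (continuous_cvg _ (@coord_continuous R T 1 j ord0 v) cv).
Qed.

Lemma dotv_cvg (vn wn : nat -> 'cV[R]_T) v w :
  (forall i, (vn n i ord0 : R^o) @[n --> \oo] --> v i ord0) ->
  (forall i, (wn n i ord0 : R^o) @[n --> \oo] --> w i ord0) ->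
  (dotv (vn n) (wn n) : R^o) @[n --> \oo] --> dotv v w.
Proof.
move=> cv cw; rewrite dotvE; under eq_fun do rewrite dotvE.
apply: cvg_big => [|j _]; first exact: add_continuous.
by apply: cvgM; [exact: cv|exact: cw].
Qed.

Lemma tv_continuous k : 0 <= k -> continuous (fun u => tv k u : R^o).
Proof.
move=> k0 u; apply: (truncated_variation_continuous
  (x := fun u i => soc_profile E u i ord0)) => // i.
rewrite (_ : (fun w => _) =
  fun w => - E^-1 * \sum_(t < T | (t < i)%N) w t ord0 : R^o).
  apply: continuousM; first exact: cst_continuous.
  have csum : continuous
      (fun w : 'cV[R]_T => \sum_(t < T | (t < i)%N) w t ord0 : R^o).
    apply: continuous_big => [|j _]; first exact: add_continuous.
    exact: coord_continuous.
  exact: csum.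
by apply/funext => w; rewrite mxE.
Qed.

(** The hinge sums of the depths are continuous, and passing to the limit keeps
    the entries sorted; the hinge sums determine a sorted vector. *)
Lemma associated_depths u N : associated E u N -> N *m u = depths u.
Proof.
move=> [v [cv _ cN]].
have cvgN i : (depths (v n) i ord0 : R^o) @[n --> \oo] --> (N *m u) i ord0.
  exact: mulmx_cvg.
apply/matrixP => i j; rewrite ord1 {j}; move: i.
apply: eq_of_hinges.
- move=> i; apply: (cvgr_to_ge (cvgN i)).
  by apply: nearW => n; exact: depths_ge0.
- exact: depths_ge0.
- move=> i j ij; apply: (ler_cvg_to (cvgN j) (cvgN i)).
  by apply: nearW => n; exact: depths_sorted.
- by move=> i j; exact: depths_sorted.
move=> k k0; rewrite sum_relu_depths //.
have lim1 : (tv k (v n) : R^o) @[n --> \oo] --> tv k u.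
  exact: (continuous_cvg _ (@tv_continuous _ k0 u) cv).
have lim2 : (tv k (v n) : R^o) @[n --> \oo] -->
    \sum_i relu ((N *m u) i ord0 - 2 * k).
  under eq_fun do rewrite -sum_relu_depths //.
  apply: cvg_big => [|j _]; first exact: add_continuous.
  apply: (continuous_cvg _ (@relu_continuous R _)).
  by apply: cvgB; [exact: cvgN|exact: cvg_cst].
exact: (cvg_unique _ lim2 lim1).
Qed.

(** Limit of the tangent inequalities of [locally_linear_subgradient]. *)
Lemma associated_subgradient u N y : associated E u N ->
  dotv (depths u) (depths u) + 2 * dotv (depths u) (N *m (y - u)) <=
    dotv (depths y) (depths y).
Proof.
move=> aN; rewrite -(associated_depths aN); have [v [cv vloc cN]] := aN.
have cvgN i : (depths (v n) i ord0 : R^o) @[n --> \oo] --> (N *m u) i ord0.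
  exact: mulmx_cvg.
have cvyv : y - v n @[n --> \oo] --> y - u.
  by apply: cvgB => //; exact: cvg_cst.
have cvgNy i : ((rainflow_mx E (v n) *m (y - v n)) i ord0 : R^o)
    @[n --> \oo] --> (N *m (y - u)) i ord0.
  exact: mulmx_cvg.
have lim : (dotv (depths (v n)) (depths (v n)) +
    2 * dotv (depths (v n)) (rainflow_mx E (v n) *m (y - v n)) : R^o)
   @[n --> \oo] -->
   dotv (N *m u) (N *m u) + 2 * dotv (N *m u) (N *m (y - u)).
  apply: cvgD; first exact: dotv_cvg.
  by apply: cvgM; [exact: cvg_cst|exact: dotv_cvg].
apply: (cvgr_to_le lim); apply: nearW => n; exact: locally_linear_subgradient.
Qed.

End Depths.

(** * Optimality of the equilibrium dispatch *)

Section Market.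
Context {R : realType} {T : nat}.
Implicit Types (u v w y : 'cV[R]_T).

Lemma degradation_costE (b E : R) u :
  degradation_cost b E u = b / 2 * dotv (depths E u) (depths E u).
Proof. by rewrite /degradation_cost /dotv /depths trmx_mul !mulmxA. Qed.

Lemma degradation_cost_subgradient (b E : R) u w y : 0 < b ->
  associated_comb E u (b *: depths E u) w ->
  degradation_cost b E u + dotv w (y - u) <= degradation_cost b E y.
Proof.
move=> b0 [m [N [gamma [_ rN g0 g1 ->]]]]; rewrite !degradation_costE.
have main k : dotv (depths E u) (depths E u) +
    2 * dotv (depths E u) (N k *m (y - u)) <=
    dotv (depths E y) (depths E y).
  by apply: associated_subgradient; rewrite -rN; exists k.
rewrite dotv_suml.
set A := dotv (depths E u) _; set B := dotv (depths E y) _.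
have -> : b / 2 * A = \sum_k gamma k * (b / 2 * A) by rewrite -mulr_suml g1 mul1r.
have -> : b / 2 * B = \sum_k gamma k * (b / 2 * B) by rewrite -mulr_suml g1 mul1r.
rewrite -big_split /=; apply: ler_sum => k _.
rewrite dotvZl -mulrDr ler_wpM2l // dotv_mulmxl dotvZl.
have := main k; rewrite -/A -/B; set C := dotv _ _ => h.
have : 0 <= b / 2 * (B - (A + 2 * C)).
  by rewrite mulr_ge0 ?subr_ge0 // divr_ge0 // ltW.
by rewrite !mulrBr mulrDr mulrA divfK ?pnatr_eq0 // subr_ge0.
Qed.

(** For a nonzero price the profit is a strictly concave quadratic in the bid,
    with maximum at [c^-1]; for price zero every bid is optimal. *)
Lemma best_bid_price (c : R) (p : 'cV[R]_T) a : 0 < c -> best_bid c p a ->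
  p = 0 \/ a = c^-1.
Proof.
move=> c0 [a0 amax]; have [->|p0] := eqVneq p 0; [by left|right].
have pp : 0 < dotv p p.
  by rewrite lt_def dotv_ge0 andbT; apply: contra_neq p0; exact: dotv_eq0.
have := amax _ (ltW (_ : 0 < c^-1)); rewrite invr_gt0 => /(_ c0).
rewrite /profit -!mulrBl ler_pM2r // => h.
have cn0 : c != 0 by rewrite gt_eqF.
have : c / 2 * (a - c^-1) ^+ 2 <= 0.
  have -> : c / 2 * (a - c^-1) ^+ 2 =
      (c^-1 - c / 2 * c^-1 ^+ 2) - (a - c / 2 * a ^+ 2) by field.
  by rewrite subr_le0.
rewrite pmulr_rle0 ?divr_gt0 // => h2.
have : (a - c^-1) ^+ 2 == 0 by rewrite eq_le h2 sqr_ge0.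
by rewrite sqrf_eq0 subr_eq0 => /eqP.
Qed.

(** A multiplier charges only constraints that are tight at [v], where any other
    feasible point can move only inwards. *)
Lemma compl_lo (mu lo v w : 'cV[R]_T) : lev 0 mu -> compl mu (v - lo) -> lev lo w ->
  0 <= dotv mu (w - v).
Proof.
move=> mu0 cmu low; rewrite (_ : w - v = (w - lo) - (v - lo)); last first.
  by apply/matrixP => i j; rewrite !mxE; ring.
rewrite dotvBr [X in _ - X](_ : _ = 0) ?subr0; last by rewrite dotvE big1.
rewrite dotvE sumr_ge0 // => t _; rewrite mulr_ge0 //.
  by have := mu0 t; rewrite mxE.
by rewrite !mxE subr_ge0.
Qed.

Lemma compl_hi (mu hi v w : 'cV[R]_T) : lev 0 mu -> compl mu (hi - v) -> lev w hi ->
  dotv mu (w - v) <= 0.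
Proof.
move=> mu0 cmu whi; rewrite (_ : w - v = (hi - v) - (hi - w)); last first.
  by apply/matrixP => i j; rewrite !mxE; ring.
rewrite dotvBr [X in X - _](_ : _ = 0) ?sub0r ?oppr_le0; last by rewrite dotvE big1.
rewrite dotvE sumr_ge0 // => t _; rewrite mulr_ge0 //.
  by have := mu0 t; rewrite mxE.
by rewrite !mxE subr_ge0.
Qed.

Lemma sqr_subgradient (c : R) v w : 0 <= c ->
  c / 2 * dotv v v + dotv (c *: v) (w - v) <= c / 2 * dotv w w.
Proof.
move=> c0; rewrite dotvZl -subr_ge0.
have -> : c / 2 * dotv w w - (c / 2 * dotv v v + c * dotv v (w - v)) =
    c / 2 * dotv (w - v) (w - v).
  by rewrite !dotvBr !dotvBl (dotvC w v); field.
by rewrite mulr_ge0 ?dotv_ge0 ?divr_ge0.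
Qed.

Lemma cst_dotv (a : R) v : dotv (cst a) v = a * dotv (cst 1) v.
Proof.
by rewrite -dotvZl; congr dotv; apply/matrixP => i j; rewrite !mxE mulr1.
Qed.

End Market.

Section Equilibrium.
Context {R : realType} {T : nat} {G S : finType}.
Variables (M : market R T G S) (alpha : G -> R) (beta : S -> R).
Variables (D : dispatch R T G S) (P : duals R T G S).
Hypothesis ceq : competitive_equilibrium M alpha beta D P.

(** A generator whose price is zero produces nothing, so that the dispatch
    determines the price even when the optimal bid is not unique. *)
Lemma marginal_gen_cost j : gcost M j *: gen D j = gen_price P j.
Proof.
have [[[[_ _ g0 _] _] _ _ [st _ _]] bestg _ _ _] := ceq.
have c0 := gcost_gt0 M j.
have genE : 0 < alpha j -> gen D j = alpha j *: gen_price P j.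
  move=> a0; rewrite /gen_price (st j a0) subrK addrK.
  by rewrite scalerA divff ?scale1r // gt_eqF.
have [a0 _] := bestg j.
have [p0|ac] := best_bid_price c0 (bestg j).
  rewrite p0; have [a00|an0] := eqVneq (alpha j) 0; first by rewrite g0 ?scaler0.
  by rewrite genE ?p0 ?scaler0 // lt_def an0.
by rewrite genE ac ?invr_gt0 // scalerA divff ?scale1r // gt_eqF.
Qed.

Lemma cycle_price i : theta P i = bcost M i *: depths (cap M i) (sto D i).
Proof.
have [_ _ bests thetaE _] := ceq; have b0 := bcost_gt0 M i.
rewrite /depths -thetaE; have [->|->] := best_bid_price b0 (bests i).
  by rewrite !scaler0.
by rewrite scalerA divff ?scale1r // gt_eqF.
Qed.

(** Price [lam P] supports the dispatch: no feasible output lowers the cost net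
    of its value at that price.  The same holds for storage in
    [sto_cost_le]. *)
Lemma gen_cost_le j (g : 'cV[R]_T) :
  lev (cst (glo M j)) g -> lev g (cst (ghi M j)) ->
  gcost M j / 2 * dotv (gen D j) (gen D j) + dotv (lam P) (g - gen D j) <=
  gcost M j / 2 * dotv g g.
Proof.
have [[_ [df _] [cs _] _] _ _ _ _] := ceq => glo_g ghi_g.
have [lo0 hi0] := df j; have [clo chi] := cs j.
apply: le_trans (sqr_subgradient (gen D j) g (ltW (gcost_gt0 M j))).
rewrite lerD2l marginal_gen_cost /gen_price dotvBl dotvDl.
have := compl_lo lo0 clo glo_g; have := compl_hi hi0 chi ghi_g; lra.
Qed.

Lemma sto_cost_le i (u : 'cV[R]_T) :
  lev (cst (ulo M i)) u -> lev u (cst (uhi M i)) -> dotv (cst 1) u = 0 ->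
  lev (cst (soc0 M - 1)) (cumul_mx (cap M i) *m u) ->
  lev (cumul_mx (cap M i) *m u) (cst (soc0 M)) ->
  degradation_cost (bcost M i) (cap M i) (sto D i) + dotv (lam P) (u - sto D i) <=
  degradation_cost (bcost M i) (cap M i) u.
Proof.
have [[[[[_ _ _ sum0 _] _ _ _] _] [_ df] [_ cs] [_ _ st]] _ _ _ _] := ceq.
move=> ulo_u uhi_u u0 soc_lo soc_hi.
have [rlo0 rhi0 mlo0 mhi0] := df i; have [rlo rhi mlo mhi] := cs i.
have [w aw lamE] := st i; rewrite cycle_price in aw.
apply: le_trans (degradation_cost_subgradient u (bcost_gt0 M i) aw).
have d0 : dotv (cst (delta P i)) (u - sto D i) = 0.
  by rewrite cst_dotv dotvBr u0 sum0 subrr mulr0.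
rewrite lerD2l lamE !(dotvBl, dotvDl) dotv_mulmxl dotvBl mulmxBr d0.
have := compl_lo rlo0 rlo ulo_u; have := compl_hi rhi0 rhi uhi_u.
have := compl_lo mlo0 mlo soc_lo; have := compl_hi mhi0 mhi soc_hi.
lra.
Qed.

End Equilibrium.

Theorem theorem3 (R : realType) (T : nat) (hT : (0 < T)%N) (G S : finType)
    (M : market R T G S) (alpha : G -> R) (beta : S -> R)
    (D : dispatch R T G S) (P : duals R T G S) :
  competitive_equilibrium M alpha beta D P ->
  solves_social_planner M (gen D) (sto D).
Proof.
move=> ceq; have [[[[feas _ _ _] _] _ _ _] _ _ _ _] := ceq.
split=> // g u [bal' gen' rate' sum' soc']; have [bal _ _ _ _] := feas.
have gle j : gcost M j / 2 * dotv (gen D j) (gen D j) +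
    dotv (lam P) (g j - gen D j) <= gcost M j / 2 * dotv (g j) (g j).
  by have [? ?] := gen' j; exact: (gen_cost_le ceq).
have ule i : degradation_cost (bcost M i) (cap M i) (sto D i) +
    dotv (lam P) (u i - sto D i) <=
    degradation_cost (bcost M i) (cap M i) (u i).
  by have [? ?] := rate' i; have [? ?] := soc' i; exact: (sto_cost_le ceq).
have gsum : \sum_j gcost M j / 2 * dotv (gen D j) (gen D j) +
    dotv (lam P) (\sum_j (g j - gen D j)) <=
    \sum_j gcost M j / 2 * dotv (g j) (g j).
  by rewrite dotv_sumr -big_split /=; apply: ler_sum => j _; exact: gle.
have usum : \sum_i degradation_cost (bcost M i) (cap M i) (sto D i) +
    dotv (lam P) (\sum_i (u i - sto D i)) <=
    \sum_i degradation_cost (bcost M i) (cap M i) (u i).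
  by rewrite dotv_sumr -big_split /=; apply: ler_sum => i _; exact: ule.
(* Both dispatches meet the demand, so their difference has value zero. *)
have lam0 : dotv (lam P) (\sum_j (g j - gen D j)) +
    dotv (lam P) (\sum_i (u i - sto D i)) = 0.
  by rewrite -dotvDr !sumrB addrACA -opprD -bal -bal' subrr /dotv mulmx0 mxE.
rewrite /social_cost; move: gsum usum lam0; lra.
Qed.
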